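(* Let $T$ be a (finite) tree on at least $2$ vertices and let $e$ be an end-edge of $T$. Then $$\lambda_1\big(\hat{A}(\mathfrak{L}(T),e)\big) < \lambda_1\big(\mathfrak{L}(T)\big).$$
   Context: For a real symmetric matrix $A$, $\lambda_1(A)$ denotes its smallest eigenvalue; for a graph $G$, $\lambda_1(G)$ denotes the smallest eigenvalue of its adjacency matrix. $\mathfrak{L}(T)$ denotes the line graph of $T$, whose vertices are the edges of $T$, two being adjacent when they share an endpoint. An end-edge of $T$ is an edge one of whose endpoints has valency $1$; it is a vertex of $\mathfrak{L}(T)$. For a graph $G$ and a vertex $v\in V(G)$, $\hat{A}(G,v)$ denotes the matrix obtained from the adjacency matrix of $G$ by replacing the diagonal entry corresponding to $v$ (which is $0$) by $-1$. *)

(* Defs.v *)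
From HB Require Import structures.
From mathcomp Require Import all_boot all_order all_algebra.
From mathcomp Require Import boolp classical_sets reals.
From mathcomp Require Import complex polyrcf.

Set Implicit Arguments.
Unset Strict Implicit.
Unset Printing Implicit Defensive.

Import Order.TTheory GRing.Theory Num.Theory.
Local Open Scope ring_scope.

Definition smallest_eigenvalue (R : realType) n (A : 'M[R]_n) (a : R) : Prop :=
  eigenvalue A a /\ forall b, eigenvalue A b -> a <= b.

(* The value is meaningful for symmetric matrices of positive size, which do
   have a smallest eigenvalue (lambda1P); otherwise it may default to 0. *)
Definition lambda1 (R : realType) n (A : 'M[R]_n) : R :=
  xget 0 (smallest_eigenvalue A).

Lemma sym_has_eigenvalue (R : realType) n (A : 'M[R]_n) :
  (0 < n)%N -> A^T = A -> exists a, eigenvalue A a.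
Proof.
move=> n_gt0 symA; pose f := real_complex R.
have [|c /[dup] rc] := @closed_rootP _ (char_poly (map_mx f A)) _.
  by rewrite size_char_poly eqSS -lt0n.
rewrite -eigenvalue_root_char => /eigenvalueP [v vA v0].
have conjA : map_mx Num.conj (map_mx f A) = map_mx f A.
  by apply/matrixP=> i j; rewrite !mxE; apply/CrealP/complex_realP; exists (A i j).
pose w : 'cV_n := (map_mx Num.conj v)^T.
have wA : map_mx f A *m w = c^* *: w.
  have symfA : (map_mx f A)^T = map_mx f A by rewrite -[in RHS]symA; apply/matrixP=> i j; rewrite !mxE.
  by rewrite -{1}symfA -trmx_mul -{1}conjA -map_mxM vA map_mxZ linearZ.
have vw0 : (v *m w) 0 0 != 0.
  have -> : (v *m w) 0 0 = \sum_i `|v 0 i| ^+ 2.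
    by rewrite mxE; apply: eq_bigr => i _; rewrite !mxE normCK.
  apply: contraNneq v0 => /eqP.
  rewrite psumr_eq0 => [/allP h|i _]; last by rewrite exprn_ge0.
  apply/eqP/rowP=> i; rewrite mxE; apply/eqP.
  by move: (h i (mem_index_enum i)); rewrite /= expf_eq0 normr_eq0.
have /matrixP /(_ 0 0) : c *: (v *m w) = c^* *: (v *m w).
  by rewrite scalemxAl -vA -mulmxA wA -scalemxAr.
rewrite !mxE -[\sum_j _]/(\sum_j v 0 j * w j 0).
have -> : \sum_j v 0 j * w j 0 = (v *m w) 0 0 by rewrite mxE.
move=> /(mulIf vw0) /esym /CrealP /complex_realP [a ca].
exists a; rewrite eigenvalue_root_char -(fmorph_root f) /= map_char_poly.
by move: rc; rewrite ca.
Qed.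

Lemma lambda1P (R : realType) n (A : 'M[R]_n) :
  (0 < n)%N -> A^T = A -> smallest_eigenvalue A (lambda1 A).
Proof.
move=> n_gt0 symA; apply: xgetPex.
have [a aA] := sym_has_eigenvalue n_gt0 symA.
have p0 : char_poly A != 0 by rewrite monic_neq0 ?char_poly_monic.
have mem_rootsR b : (b \in rootsR (char_poly A)) = eigenvalue A b.
  by rewrite -(roots_on_rootsR p0) eigenvalue_root_char.
have srt : sorted <%R (rootsR (char_poly A)) by exact: sorted_roots.
case Er: (rootsR (char_poly A)) srt => [|b s].
  by move: aA; rewrite -mem_rootsR Er.
move=> bs; exists b; split; first by rewrite -mem_rootsR Er mem_head.
move=> c; rewrite -mem_rootsR Er inE => /predU1P [->//|cs].
by apply: ltW; move: (order_path_min lt_trans bs) => /allP; apply.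
Qed.

Record sgraph := SGraph {
  vertex :> finType;
  adj : rel vertex;
  adj_sym : symmetric adj;
  adj_irrefl : irreflexive adj }.

(* In the sense of ucycleb, [:: x; y] is a cycle as soon as x and y are
   adjacent, so graph cycles are those of size at least 3. *)
Definition is_tree (G : sgraph) : Prop :=
  [/\ (0 < #|G|)%N,
      forall x y : G, connect (@adj G) x y
    & forall c : seq G, (2 < size c)%N -> ~~ ucycleb (@adj G) c].

Definition valency (G : sgraph) (x : G) : nat := #|[set y | adj x y]|.

Definition edges (G : sgraph) : {set {set G}} :=
  [set f : {set G} | [exists x, exists y, adj x y && (f == [set x; y])]].

Definition edge (G : sgraph) : finType := {f : {set G} | f \in edges G}.

Definition end_edge (G : sgraph) (f : edge G) : Prop :=
  exists2 x : G, x \in val f & valency x = 1%N.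

Definition line_adj (G : sgraph) : rel (edge G) :=
  fun f g => (f != g) && ~~ [disjoint val f & val g].

Lemma line_adj_sym G : symmetric (@line_adj G).
Proof. by move=> f g; rewrite /line_adj eq_sym disjoint_sym. Qed.

Lemma line_adj_irrefl G : irreflexive (@line_adj G).
Proof. by move=> f; rewrite /line_adj eqxx. Qed.

Definition line_graph (G : sgraph) : sgraph :=
  SGraph (@line_adj_sym G) (@line_adj_irrefl G).

(* Rows and columns follow the enumeration enum_val of the vertices. *)
Definition adjmx (R : realType) (G : sgraph) : 'M[R]_#|G| :=
  \matrix_(i, j) (adj (enum_val i : G) (enum_val j : G))%:R.

Definition adjmx_hat (R : realType) (G : sgraph) (v : G) : 'M[R]_#|G| :=
  \matrix_(i, j) if (enum_val i == v) && (enum_val j == v) then -1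
                 else adjmx R G i j.

Definition graph_lambda1 (R : realType) (G : sgraph) : R := lambda1 (adjmx R G).

(* Main.v *)
Require Import Defs.
From mathcomp Require Import all_boot all_order all_algebra reals.
From mathcomp Require Import complex sesquilinear spectral lra zify.
Local Open Scope ring_scope.
Set Implicit Arguments.
Unset Strict Implicit.
Import Order.TTheory GRing.Theory Num.Theory.

(** Let N be the vertex-edge incidence matrix of the tree T, let A be the
    adjacency matrix of its line graph, and let r be a leaf of T on e. Then
    A + 2 I = N^T N ([line_graph_form]), and since e is the only edge at r,
    lowering the diagonal entry at e by 1 amounts to deleting from N the row
    of r.

    Let x be an eigenvector of A for its smallest eigenvalue l. If x e <> 0, then
    x itself has a smaller Rayleigh quotient for the modified matrix, but x may
    well vanish at e. It is therefore replaced by another vector z, with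
    |(N z)_a| = |(N x)_a| at every vertex a other than r. Root T at r. Removing
    an edge cuts off a subtree away from r, and the entries of a vector solving
    N x = y off r are alternating sums of y over these subtrees. Choosing the
    signs of y to alternate with the depth leaves no cancellation: the entries of
    z are, in absolute value, the sums of |N x| over the subtrees. Hence
    |x f| <= |z f| for every f, and z e <> 0, because the subtree below e is all
    of T but r ([alternating_subtree_vector]).

    Writing Q for the form of the modified matrix plus 2 I,
    Q(z) = Q(x) = (l + 2) |x|^2 - (x e)^2 < (l + 2) |z|^2: either x e <> 0, or
    x e = 0 <> z e and then |x| < |z|. By the variational characterization of
    the smallest eigenvalue ([lambda1_rayleigh]) this is the claim. *)

(** * The Rayleigh bound for the smallest eigenvalue *)

Section Rayleigh.
Local Open Scope sesquilinear_scope.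

(** A is diagonalized over R[i] in a unitary basis. Its eigenvalues there are
    real, so they are eigenvalues over R and at least [lambda1 A]. *)
Lemma lambda1_rayleigh (R : realType) n (A : 'M[R]_n) (x : 'rV[R]_n) :
  A^T = A -> lambda1 A * (x *m x^T) 0 0 <= (x *m A *m x^T) 0 0.
Proof.
move=> symA; have [n0|n_gt0] := posnP n.
  by subst n; rewrite !mxE !big_ord0 mulr0.
have [_ minA] := lambda1P n_gt0 symA.
pose f := real_complex R; pose B := map_mx f A.
have realf r : (f r)^* = f r by apply/CrealP/complex_realP; exists r.
have hermB : B \is hermsymmx.
  apply/is_hermitianmxP; rewrite expr0 scale1r.
  by apply/matrixP=> i j; rewrite !mxE realf -[in RHS]symA mxE.
(* y lists the coordinates of x in an orthonormal eigenbasis of A, the rows of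
   P; in it both quadratic forms become weighted sums of the |y_i| ^ 2. *)
pose P := spectralmx B; pose D := spectral_diag B.
have unitP : P \is unitarymx := spectral_unitarymx B.
have BE : B = invmx P *m diag_mx D *m P.
  exact/orthomx_spectralP/hermitian_normalmx.
have eigD i : exists2 d, D 0 i = f d & lambda1 A <= d.
  have /mxOverP /(_ 0 i) := hermitian_spectral_diag_real hermB.
  move=> /complex_realP [d Dd]; exists d => //; apply: minA.
  rewrite eigenvalue_root_char -(fmorph_root f) /= map_char_poly -/B.
  rewrite -Dd.
  rewrite -eigenvalue_root_char; apply/eigenvalueP; exists (row i P).
    rewrite {1}BE -mulmxA !mulmxA -row_mul mulmxV ?spectral_unit // row1.
    by rewrite -rowE row_diag_mx -scalemxAl -rowE.
  apply: contraTneq (spectral_unit B) => Pi0; rewrite -row_free_unit.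
  apply/negP => /row_freeP [Q /(congr1 (row i))]; rewrite row_mul Pi0 mul0mx.
  by move=> /rowP /(_ i); rewrite !mxE eqxx => /esym /eqP; rewrite oner_eq0.
pose y := map_mx f x *m P^t*.
have yE : y^t* = P *m (map_mx f x)^T.
  rewrite /y trmx_mul map_mxM trmxCK; congr (_ *m _).
  by apply/matrixP=> i j; rewrite !mxE; apply: realf.
have sq C : (y *m diag_mx C *m y^t*) 0 0 = \sum_i C 0 i * `|y 0 i| ^+ 2.
  rewrite mxE; apply: eq_bigr => i _; rewrite mul_mx_diag !mxE normCK.
  by rewrite mulrAC mulrC mulrA.
have fM a b : f (a * b) = f a * f b by apply: rmorphM.
rewrite -lecR.
change (f (lambda1 A * (x *m x^T) 0 0) <= f ((x *m A *m x^T) 0 0)); rewrite fM.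
have <- : (y *m diag_mx (const_mx 1) *m y^t*) 0 0 = f ((x *m x^T) 0 0).
  rewrite diag_const_mx mulmx1 yE /y -mulmxA (mulmxA _ P) -invmx_unitary //.
  by rewrite mulVmx ?spectral_unit // mul1mx map_trmx -map_mxM mxE.
have <- : (y *m diag_mx D *m y^t*) 0 0 = f ((x *m A *m x^T) 0 0).
  rewrite yE /y -invmx_unitary // !mulmxA -2!(mulmxA (map_mx f x)) -BE.
  by rewrite map_trmx -!map_mxM mxE.
rewrite !sq mulr_sumr; apply: ler_sum => i _; have [d -> le_d] := eigD i.
by rewrite mxE mul1r ler_wpM2r ?exprn_ge0 // lecR.
Qed.

End Rayleigh.

(** * Quadratic forms of a line graph *)

Definition vertex_row (R : realType) (G : sgraph) (x : G -> R) : 'rV[R]_#|G| :=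
  \row_i x (enum_val i).

Definition adj_form (R : realType) (G : sgraph) (x : G -> R) : R :=
  \sum_f \sum_g (adj f g)%:R * (x f * x g).

Section Forms.
Variables (R : realType) (G : sgraph).
Implicit Types (x : G -> R) (v : G).

Lemma sum_enum_val (F : G -> R) : \sum_(i < #|G|) F (enum_val i) = \sum_x F x.
Proof. by rewrite [RHS](reindex _ (onW_bij _ (@enum_val_bij G))). Qed.

Lemma vertex_row_dot x : (vertex_row x *m (vertex_row x)^T) 0 0 = \sum_f x f ^+ 2.
Proof.
rewrite mxE -[RHS]sum_enum_val; apply: eq_bigr => i _.
by rewrite !mxE expr2.
Qed.

Lemma vertex_row_form x (F : G -> G -> R) (A : 'M[R]_#|G|) :
  (forall i j, A i j = F (enum_val i) (enum_val j)) ->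
  (vertex_row x *m A *m (vertex_row x)^T) 0 0 = \sum_f \sum_g F f g * (x f * x g).
Proof.
move=> AE; rewrite exchange_big /= -sum_enum_val mxE; apply: eq_bigr => j _.
rewrite !mxE mulr_suml -sum_enum_val; apply: eq_bigr => i _.
by rewrite !mxE AE mulrAC mulrC.
Qed.

Lemma vertex_row_adjmx x :
  (vertex_row x *m adjmx R G *m (vertex_row x)^T) 0 0 = adj_form x.
Proof. by apply: vertex_row_form => i j; rewrite mxE. Qed.

Lemma adjmx_sym : (adjmx R G)^T = adjmx R G.
Proof. by apply/matrixP=> i j; rewrite !mxE adj_sym. Qed.

Lemma adjmx_hat_sym v : (adjmx_hat R v)^T = adjmx_hat R v.
Proof. by apply/matrixP=> i j; rewrite !mxE andbC adj_sym. Qed.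

Lemma vertex_row_adjmx_hat x v :
  (vertex_row x *m adjmx_hat R v *m (vertex_row x)^T) 0 0 = adj_form x - x v ^+ 2.
Proof.
pose F f g : R := (adj f g)%:R - ((f == v) && (g == v))%:R.
rewrite (@vertex_row_form x F) => [|i j]; last first.
  rewrite !mxE /F; case: ifP => [|_]; last by rewrite subr0.
  case/andP=> /eqP -> /eqP ->.
  by rewrite adj_irrefl sub0r.
under eq_bigr => f _.
  under eq_bigr => g _ do rewrite /F mulrBl.
  rewrite sumrB; over.
rewrite sumrB; congr (_ - _).
rewrite (bigD1 v) //= (bigD1 v) //= !big1 => [|f /negPf fv|g /negPf gv].
- by rewrite eqxx mul1r !addr0 expr2.
- by rewrite big1 // => g _; rewrite fv mul0r.
- by rewrite gv andbF mul0r.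
Qed.
End Forms.

Lemma edgeP (T : sgraph) (f : edge T) :
  exists a b, adj a b /\ val f = [set a; b].
Proof.
have := valP f; rewrite inE => /existsP [a /existsP [b /andP [ab /eqP fE]]].
by exists a, b.
Qed.

Lemma card_edge (T : sgraph) (f : edge T) : #|val f| = 2%N.
Proof.
have [a [b [ab ->]]] := edgeP f; rewrite cards2; case: eqP ab => // ->.
by rewrite adj_irrefl.
Qed.

Lemma card_edgeI (T : sgraph) (f g : line_graph T) :
  #|val f :&: val g| = (adj f g + (f == g).*2)%N.
Proof.
have [<-|fg] := eqVneq f g; first by rewrite setIid card_edge adj_irrefl.
rewrite /= /line_adj fg -setI_eq0 -card_gt0 addn0 /=.
have : (#|val f :&: val g| < 2)%N; last by case: #|_| => [|[]].
rewrite ltnNge; apply: contra fg => le2.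
have fI : val f :&: val g = val f.
  by apply/eqP; rewrite eqEcard subsetIl card_edge.
have gI : val f :&: val g = val g.
  by apply/eqP; rewrite eqEcard subsetIr card_edge.
by apply/eqP/val_inj; rewrite -fI {1}gI.
Qed.

(** With N the vertex-edge incidence matrix, the adjacency matrix of the line
    graph plus twice the identity is N^T N: its (f, g) entry is the number of
    common endpoints of f and g. The left-hand side is |N x|^2. *)
Lemma line_graph_form (R : realType) (T : sgraph) (x : line_graph T -> R) :
  \sum_(a : T) (\sum_(f : edge T | a \in val f) x f) ^+ 2 =
  adj_form x + 2 * \sum_f x f ^+ 2.
Proof.
transitivity (\sum_(f : line_graph T) \sum_(g : line_graph T)
    #|val f :&: val g|%:R * (x f * x g)).
  under eq_bigr => a _ do rewrite expr2 big_distrlr /= big_mkcond.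
  rewrite exchange_big; apply: eq_bigr => f _ /=.
  under [RHS]eq_bigr => g _.
    rewrite -sum1_card natr_sum mulr_suml big_mkcond; over.
  rewrite [RHS]exchange_big; apply: eq_bigr => a _ /=.
  case: ifP => af; last by rewrite big1 // => g _; rewrite inE af.
  by rewrite big_mkcond; apply: eq_bigr => g _; rewrite inE af mul1r.
rewrite /adj_form mulr_sumr -big_split; apply: eq_bigr => f _ /=.
under eq_bigr => g _ do rewrite card_edgeI natrD mulrDl.
rewrite big_split; congr (_ + _); rewrite (bigD1 f) //= eqxx big1 ?addr0 //.
by move=> g; rewrite eq_sym => /negPf ->; rewrite mul0r.
Qed.

(** * Rooted trees *)

(** [d] is the depth and [p] the parent. The last clause is where acyclicity
    enters: it says that there are no edges besides the parent edges. *)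
Definition rooting (T : sgraph) (r : T) (d : T -> nat) (p : T -> T) : Prop :=
  [/\ forall a, a != r -> adj a (p a),
      forall a, a != r -> d a = (d (p a)).+1
    & forall a b, adj a b -> a != r /\ p a = b \/ b != r /\ p b = a].

(** The depth is the distance to r, and a parent of a is the last but one vertex
    of a shortest path from r to a. *)
Lemma connected_parent (T : sgraph) (r : T) :
  (forall x y : T, connect (@adj T) x y) ->
  exists d : T -> nat, exists p : T -> T,
    forall a, a != r -> adj a (p a) /\ d a = (d (p a)).+1.
Proof.
move=> conT.
pose P a n := [exists t : n.-tuple T, path (@adj T) r t && (last r t == a)].
have exP a : exists n, P a n.
  have /connectP [s rs ->] := conT r a.
  by exists (size s); apply/existsP; exists (in_tuple s); rewrite rs eqxx.
pose d a := ex_minn (exP a).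
have parent a : a != r -> exists b, adj a b && (d a == (d b).+1).
  move=> a_r; rewrite /d; case: (ex_minnP (exP a)) => n /existsP [t].
  case/andP=> rt /eqP rta minn.
  have := size_tuple t.
  case/lastP: (tval t) rt rta => [_ ra|s b]; first by rewrite -ra eqxx in a_r.
  rewrite rcons_path last_rcons => /andP [rs ab] ba; rewrite size_rcons => sn.
  subst b; exists (last r s); rewrite adj_sym ab /=.
  case: ex_minnP => m /existsP [t' /andP [rt' /eqP t'l]] minm.
  have le_m : (m <= size s)%N.
    by apply: minm; apply/existsP; exists (in_tuple s); rewrite rs eqxx.
  have le_n : (n <= m.+1)%N.
    apply: minn; apply/existsP; exists [tuple of rcons t' a] => /=.
    by rewrite rcons_path last_rcons rt' t'l ab eqxx.
  by rewrite eqn_leq le_n -sn ltnS.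
exists d, (fun a => odflt r [pick b | adj a b && (d a == (d b).+1)]) => a a_r.
case: pickP => [b /andP [ab /eqP ->] //|none].
by have [b] := parent a a_r; rewrite none.
Qed.

(** The parent edges alone already connect every vertex to r. An edge ab which is
    not a parent edge would therefore close a simple path of parent edges from
    a to b into a cycle. *)
Lemma tree_rooting (T : sgraph) (r : T) :
  is_tree T -> exists d p, rooting r d p.
Proof.
case=> _ conT acyc; have [d [p dp]] := connected_parent r conT.
exists d, p; split=> [a /dp[]|a /dp[]|a b ab] //.
pose e := [rel x y | (x != r) && (p x == y) || (y != r) && (p y == x)].
have [/orP[] /andP[? /eqP ?]|e'ab] := boolP (e a b); [by left|by right|].
have sym_e : connect_sym e by apply: sym_connect_sym => x y; apply: orbC.
have sub_e x y : e x y -> adj x y.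
  by case/orP=> /andP [/dp [+ _] /eqP <-] => //; rewrite adj_sym.
have root_conn x : connect e x r.
  have [n] := ubnP (d x); elim: n x => // n IHn x; rewrite ltnS => le_n.
  have [->|x_r] := eqVneq x r; first exact: connect0.
  apply: connect_trans (IHn (p x) _).
    by apply: connect1; rewrite /= x_r eqxx.
  by have [_ <-] := dp x x_r.
have : connect e a b by apply: connect_trans (root_conn a) _; rewrite sym_e.
case/connectP=> _ /shortenP [s es us _] sb; exfalso.
have := acyc (a :: s); rewrite /ucycleb us /= rcons_path (sub_path sub_e es).
rewrite -sb adj_sym ab /= => short.
(* The path has at least two steps, since ab is not a parent edge itself. *)
case: s es sb short {us} => [|c [|c' s]] /= es sb short.
- by rewrite sb adj_irrefl in ab.
- by move: es e'ab; rewrite sb andbT /= => ->.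
by have := short isT.
Qed.

(** * Sums over subtrees *)

Section ParentEdges.
Variables (T : sgraph) (r : T) (d : T -> nat) (p : T -> T) (e0 : edge T).
Hypothesis rdp : rooting r d p.

(** [e0] is a default, returned only when [set a; p a] is not an edge, which
    happens at most for the root. *)
Definition parent_edge (a : T) : edge T := insubd e0 [set a; p a].

Lemma val_parent_edge a : a != r -> val (parent_edge a) = [set a; p a].
Proof.
have [adj_p _ _] := rdp => /adj_p ap; apply: insubdK.
rewrite inE; apply/existsP; exists a; apply/existsP; exists (p a).
by rewrite ap eqxx.
Qed.

Lemma parent_edge_inj : {in [pred a | a != r] &, injective parent_edge}.
Proof.
have [_ dp _] := rdp => a b; rewrite !inE => ar br /(congr1 val).
rewrite !val_parent_edge // => ab.
have : a \in [set b; p b] by rewrite -ab set21.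
have : b \in [set a; p a] by rewrite ab set21.
rewrite !inE => /orP[/eqP //|/eqP bE] /orP[/eqP //|/eqP aE].
by have := dp a ar; rewrite -bE (dp b br) -aE; lia.
Qed.

Lemma parent_edge_surj f : exists2 a, a != r & f = parent_edge a.
Proof.
have [_ _ adjE] := rdp; have [a [b [ab fE]]] := edgeP f.
case: (adjE a b ab) => [] [xr px]; [exists a | exists b] => //;
  by apply: val_inj; rewrite val_parent_edge // px fE // setUC.
Qed.

Lemma sum_edges (R : realType) (F : edge T -> R) :
  \sum_f F f = \sum_(a | a != r) F (parent_edge a).
Proof.
rewrite -[RHS](big_imset _ parent_edge_inj) /=.
by apply: eq_bigl => f; apply/esym/imsetP; apply: parent_edge_surj.
Qed.

(** The edges at a are its own parent edge and the parent edges of its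
    children. *)
Lemma sum_incident (R : realType) (F : edge T -> R) a :
  \sum_(f : edge T | a \in val f) F f =
  (if a != r then F (parent_edge a) else 0) +
  \sum_(c | (c != r) && (p c == a)) F (parent_edge c).
Proof.
have [_ dp _] := rdp.
rewrite big_mkcond sum_edges.
transitivity (\sum_(c | c != r) ((if c == a then F (parent_edge c) else 0) +
                       if p c == a then F (parent_edge c) else 0)).
  apply: eq_bigr => c cr; rewrite val_parent_edge // !inE !(eq_sym a).
  case: eqVneq => [ca|_] /=; last by rewrite add0r.
  case: eqVneq => [pca|_] /=; last by rewrite addr0.
  by have := dp c cr; rewrite pca ca; lia.
rewrite big_split /= -!big_mkcondr; congr (_ + _).
case: ifP => ar.
  by rewrite (big_pred1 a) // => c; rewrite /= andbC; case: eqP => // ->.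
by rewrite big_pred0 // => c; case: (eqVneq c a) => [->|_]; rewrite ?ar ?andbF.
Qed.

(** Induction from the leaves up, well founded because depths are bounded. *)
Lemma children_ind (Q : T -> Prop) :
  (forall a, (forall c, c != r -> p c = a -> Q c) -> Q a) -> forall a, Q a.
Proof.
have [_ dp _] := rdp => step a.
have [n] := ubnP (\max_b d b - d a).
elim: n a => // n IHn a; rewrite ltnS => le_n; apply: step => c cr pc; apply: IHn.
have := dp c cr; rewrite pc => dc; have := leq_bigmax (F := d) c; lia.
Qed.

(** Structural recursion on a bound n on the number of levels below a. *)
Fixpoint descendant_sum (R : realType) (w : T -> R) (n : nat) (a : T) : R :=
  if n is n'.+1 then
    w a + \sum_(c | (c != r) && (p c == a)) descendant_sum w n' c
  else 0.

(** Z a is the sum of w over the subtree below a, including a itself. *)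
Lemma subtree_sum_exists (R : realType) (w : T -> R) :
  exists Z : T -> R,
    forall a, Z a = w a + \sum_(c | (c != r) && (p c == a)) Z c.
Proof.
have [_ dp _] := rdp; pose N := (\max_b d b).+1.
exists (fun a => descendant_sum w (N - d a) a) => a.
have le_d c : (d c <= \max_b d b)%N by apply: leq_bigmax.
rewrite /N subSn //=; congr (_ + _).
apply: eq_bigr => c /andP [cr /eqP pc]; congr descendant_sum.
by have := dp c cr; rewrite pc; have := le_d c; lia.
Qed.

Section SubtreeSum.
Variables (R : realType) (w Z : T -> R).
Hypothesis w_ge0 : forall a, 0 <= w a.
Hypothesis Z_eq : forall a, Z a = w a + \sum_(c | (c != r) && (p c == a)) Z c.

Lemma subtree_sum_ge0 a : 0 <= Z a.
Proof.
elim/children_ind: a => a IH; rewrite Z_eq addr_ge0 // sumr_ge0 // => c.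
by case/andP=> cr /eqP /IH; apply.
Qed.

Lemma subtree_sum_ge a : w a <= Z a.
Proof. by rewrite Z_eq lerDl sumr_ge0 // => c _; apply: subtree_sum_ge0. Qed.

Lemma subtree_sum_parent c : c != r -> Z c <= Z (p c).
Proof.
move=> cr; rewrite (Z_eq (p c)) (bigD1 c) /= ?cr ?eqxx // addrCA lerDl.
by rewrite addr_ge0 // sumr_ge0 // => b _; apply: subtree_sum_ge0.
Qed.

(** Solving for X a from the leaves up and applying the triangle inequality. *)
Lemma subtree_sum_dominates (X : T -> R) :
    (forall a, a != r ->
      w a = `|X a + \sum_(c | (c != r) && (p c == a)) X c|) ->
  forall a, a != r -> `|X a| <= Z a.
Proof.
move=> wE; elim/children_ind => a IH ar; rewrite Z_eq wE //.
rewrite -[X a](addrK (\sum_(c | (c != r) && (p c == a)) X c)).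
apply: le_trans (ler_normB _ _) _; rewrite addrK lerD2l.
apply: le_trans (ler_norm_sum _ _ _) _; apply: ler_sum => c /andP [cr /eqP pc].
exact: IH.
Qed.
End SubtreeSum.
End ParentEdges.

(** * The test vector and the strict inequality *)

Lemma end_edge_unique (T : sgraph) (r : T) (e f : edge T) :
  valency r = 1%N -> r \in val e -> r \in val f -> f = e.
Proof.
move=> /eqP/cards1P [u nbr].
have star (g : edge T) : r \in val g -> val g = [set r; u].
  have [a [b [ab gE]]] := edgeP g; rewrite gE !inE.
  have nbrE c : adj r c -> c = u by move=> rc; apply/set1P; rewrite -nbr inE.
  case/orP=> /eqP rE; subst r; first by rewrite (nbrE b).
  by rewrite setUC (nbrE a) // adj_sym.
by move=> /star re /star rf; apply: val_inj; rewrite re rf.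
Qed.

(** Root the tree at the leaf r of e and let
    w a = |sum of x over the edges at a|. Then z is, up to a sign alternating
    with the depth, the sum of w over the subtree cut off by an edge. The signs
    make (N z)_a = +- w a at every a other than r, which gives the equality of
    forms: subtracting the square at e amounts to deleting the row of N indexed
    by r. The absolute values in w let nothing cancel, so z dominates x, and z e
    collects w over all vertices but r. *)
Lemma alternating_subtree_vector (R : realType) (T : sgraph) (e : line_graph T)
    (x : line_graph T -> R) :
  is_tree T -> end_edge e -> (exists f, x f != 0) ->
  exists z : line_graph T -> R,
    [/\ forall f, `|x f| <= `|z f|, z e != 0,
        adj_form z + 2 * (\sum_f z f ^+ 2) - z e ^+ 2 =
        adj_form x + 2 * (\sum_f x f ^+ 2) - x e ^+ 2
      & 0 < adj_form x + 2 * (\sum_f x f ^+ 2) - x e ^+ 2].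
Proof.
move=> treeT [r re leaf_r] [f0 xf0].
have [d [p rdp]] := tree_rooting r treeT; have [_ dp _] := rdp.
pose up := parent_edge p e.
pose w a := `|\sum_(f : edge T | a \in val f) x f|.
have w_ge0 a : 0 <= w a by apply: normr_ge0.
have [Z Z_eq] := subtree_sum_exists rdp w.
have wE a : a != r ->
    w a = `|x (up a) + \sum_(c | (c != r) && (p c == a)) x (up c)|.
  by move=> ar; rewrite /w (sum_incident e rdp) ar.
have xZ := subtree_sum_dominates rdp Z_eq wE.
(* A single vertex contributes to this sum, the lower endpoint of f. *)
pose z (f : line_graph T) :=
  \sum_(a | (a != r) && (up a == f)) (-1) ^+ d a * Z a.
have zE c : c != r -> z (up c) = (-1) ^+ d c * Z c.
  move=> cr; rewrite /z (big_pred1 c) // => a /=.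
  apply/andP/eqP => [[ar /eqP /(parent_edge_inj rdp)]|->]; last by rewrite cr.
  by apply; rewrite inE.
have normz c : c != r -> `|z (up c)| = Z c.
  move=> cr; rewrite zE // normrMsign ger0_norm //.
  exact: (subtree_sum_ge0 rdp w_ge0 Z_eq).
have upP f : exists2 c, c != r & f = up c := parent_edge_surj e rdp f.
have at_root (y : line_graph T -> R) : \sum_(f : edge T | r \in val f) y f = y e.
  rewrite (big_pred1 e) // => f; apply/idP/eqP => [|->//].
  exact: end_edge_unique.
have Nz a : a != r -> (\sum_(f : edge T | a \in val f) z f) ^+ 2 = w a ^+ 2.
  move=> ar; rewrite (sum_incident e rdp) ar zE //.
  transitivity (((-1) ^+ d a * w a) ^+ 2); last by rewrite exprMn sqrr_sign mul1r.
  congr (_ ^+ 2); rewrite -[w a](addrK (\sum_(c | (c != r) && (p c == a)) Z c)).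
  rewrite -Z_eq mulrBr; congr (_ + _); rewrite mulr_sumr -sumrN.
  apply: eq_bigr => c /andP [cr /eqP pc].
  by rewrite zE // dp // pc exprS mulN1r mulNr.
have form (y : line_graph T -> R) :
    adj_form y + 2 * (\sum_f y f ^+ 2) - y e ^+ 2 =
    \sum_(a | a != r) (\sum_(f : edge T | a \in val f) y f) ^+ 2.
  by rewrite -line_graph_form (bigD1 r) //= at_root addrAC subrr add0r.
(* If w vanished off the root, so would Z, hence x by domination. *)
have [a ar wa] : exists2 a, a != r & 0 < w a.
  have [/existsP [a /andP [ar wa]]|/existsPn noa] :=
    boolP [exists a, (a != r) && (0 < w a)]; first by exists a.
  have Z0 a : a != r -> Z a <= 0.
    elim/(children_ind rdp): a => a IH ar; rewrite Z_eq -[leRHS]addr0 lerD //.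
      by have := noa a; rewrite ar /= -leNgt.
    by apply: sumr_le0 => c /andP [cr /eqP pc]; apply: IH.
  have [c cr f0E] := upP f0; case/negP: xf0.
  by rewrite -normr_le0 f0E (le_trans (xZ c cr)) // Z0.
(* The path from b to r enters r through e, the only edge at the leaf r. *)
have Z_e b : b != r -> Z b <= `|z e|.
  have [n] := ubnP (d b); elim: n b => // n IHn b; rewrite ltnS => le_n br.
  have [pb|pbr] := eqVneq (p b) r.
    suff <- : up b = e by rewrite normz.
    apply: (end_edge_unique leaf_r re).
    by rewrite (val_parent_edge e rdp) // pb set22.
  apply: le_trans (subtree_sum_parent rdp w_ge0 Z_eq br) _.
  by apply: IHn => //; rewrite -dp.
exists z; split.
- by move=> f; have [c cr ->] := upP f; rewrite normz //; apply: xZ.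
- rewrite -normr_gt0 (lt_le_trans wa) // (le_trans _ (Z_e a ar)) //.
  exact: (subtree_sum_ge rdp w_ge0 Z_eq).
- by rewrite !form; apply: eq_bigr => b br; rewrite Nz // /w real_normK ?num_real.
rewrite form (bigD1 a) //= ltr_wpDr ?sumr_ge0 // => [b _|]; first exact: sqr_ge0.
by rewrite -real_normK ?num_real // exprn_gt0.
Qed.

Theorem theorem1 (R : realType) (T : sgraph) (e : line_graph T) :
  is_tree T -> (2 <= #|T|)%N -> end_edge e ->
  lambda1 (adjmx_hat R e) < graph_lambda1 R (line_graph T).
Proof.
move=> treeT _ end_e.
have n_gt0 : (0 < #|line_graph T|)%N by apply/card_gt0P; exists e.
have [/eigenvalueP [u uA u0] _] := lambda1P n_gt0 (adjmx_sym R (line_graph T)).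
pose x (f : line_graph T) : R := u 0 (enum_rank f).
have xE : vertex_row x = u by apply/rowP=> i; rewrite mxE /x enum_valK.
have x_neq0 : exists f, x f != 0.
  by have /rV0Pn [i ui] := u0; exists (enum_val i); rewrite /x enum_valK.
have qx : adj_form x = graph_lambda1 R (line_graph T) * \sum_f x f ^+ 2.
  by rewrite -vertex_row_adjmx -vertex_row_dot xE uA -scalemxAl mxE.
have [z [xz ze eq_form form_gt0]] :=
  alternating_subtree_vector treeT end_e x_neq0.
have := lambda1_rayleigh (vertex_row z) (adjmx_hat_sym R e).
rewrite vertex_row_dot vertex_row_adjmx_hat ltNge => ray; apply/negP.
move: ray eq_form form_gt0; rewrite qx.
move: (lambda1 _) (graph_lambda1 _ _) => l' l.
have sq_le f : x f ^+ 2 <= z f ^+ 2.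
  rewrite -[x f ^+ 2]real_normK ?num_real // -[leRHS]real_normK ?num_real //.
  by rewrite lerXn2r ?nnegrE.
have gap : z e ^+ 2 - x e ^+ 2 <= \sum_f z f ^+ 2 - \sum_f x f ^+ 2.
  by rewrite -sumrB (bigD1 e) //= lerDl sumr_ge0 // => f _; rewrite subr_ge0.
have s_ge0 : 0 <= \sum_f x f ^+ 2 by rewrite sumr_ge0 // => f _; apply: sqr_ge0.
have ze2 : 0 < z e ^+ 2 by rewrite exprn_even_gt0.
have xe2 : 0 <= x e ^+ 2 by apply: sqr_ge0.
move: gap s_ge0 ze2 xe2 (sq_le e).
move: (\sum_f z f ^+ 2) (\sum_f x f ^+ 2) (adj_form z) (z e ^+ 2) (x e ^+ 2).
move=> t s q c b gap s_ge0 c_gt0 b_ge0 bc ray eq_form form_gt0 le_l.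
(* (l + 2) s = |N x|^2 > 0. *)
have m_gt0 : 0 < l + 2.
  have ms : 0 < (l + 2) * s by lra.
  have s_gt0 : 0 < s.
    by rewrite lt_neqAle s_ge0 andbT; apply: contraTneq ms => <-; lra.
  by rewrite pmulr_lgt0 in ms.
(* If l <= l', the Rayleigh bound at z gives (l + 2)(t - s) <= - b, whereas
   t - s >= c - b >= 0; so b = 0, and then (l + 2) c <= 0, a contradiction. *)
have ts : l * t <= l' * t by rewrite ler_wpM2r //; lra.
have : (l + 2) * (c - b) <= (l + 2) * (t - s) by rewrite ler_wpM2l // ltW.
have : (l + 2) * b <= (l + 2) * c by rewrite ler_wpM2l // ltW.
have : 0 < (l + 2) * c by rewrite mulr_gt0.
move=> h1 h2 h3.
have b0 : b = 0 by apply: le_anti; rewrite b_ge0 andbT; lra.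
by move: h3; rewrite b0; lra.
Qed.
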